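(* Let $K$ be a field, $S=K[x_1,\ldots,x_n]$ with $n>1$, and let $I_{\mathbf a,n,d}\subset S$ be a Veronese type ideal, where $d\geq 0$ is an integer, $\mathbf a=(a_1,\ldots,a_n)$ is an integer vector with $a_1\geq a_2\geq\cdots\geq a_n\geq 0$, and $\sum_{i=1}^n a_i\geq d$. Let $\mathbf e=(1,\ldots,1)\in\mathbb Z^n$. Then: (a) for all $\ell\geq 0$, $J_\ell(I_{\mathbf a,n,d})=I_{\mathbf a-\ell\mathbf e,n,d-\ell}$; (b) $\displaystyle \operatorname{sat}(I_{\mathbf a,n,d})=\min\left\{\left\lfloor \frac{\sum_{i=1}^{n}a_i-d}{n-1}\right\rfloor,\ a_n,\ d\right\}$.
   Context: $\mathfrak m=(x_1,\ldots,x_n)$. For integers $n\geq 1$ and $d$ and an integer vector $\mathbf a=(a_1,\ldots,a_n)$ with $a_1\ge\cdots\ge a_n$ (entries of $\mathbf a$ and $d$ may be negative), the Veronese type ideal $I_{\mathbf a,n,d}\subset S$ is the monomial ideal generated by all monomials $x_1^{b_1}\cdots x_n^{b_n}$ with integers $b_i\geq 0$, $\sum_{i=1}^n b_i=d$ and $b_i\leq a_i$ for $i=1,\ldots,n$ (it is $0$ if there are none). For a monomial ideal $I$ put $J_0(I)=I$, and for $\ell\ge 1$ let $J_\ell(I)$ be the ideal generated by the monomials in $(I:\mathfrak m^{\ell})\setminus (I:\mathfrak m^{\ell-1})$. The saturation number is $\operatorname{sat}(I)=\min\{k\ge 0: I:\mathfrak m^k=I:\mathfrak m^{k+1}\}$.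 *)

(* Defs.v *)
From mathcomp Require Import all_boot all_order all_algebra.
From mathcomp Require Import classical_sets.
From mathcomp Require Import mpoly.

Set Implicit Arguments.
Unset Strict Implicit.
Unset Printing Implicit Defensive.

Import GRing.Theory.

Local Open Scope ring_scope.
Local Open Scope classical_set_scope.

Section Ideals.
Variable R : comNzRingType.
Implicit Types I J G : set R.

(* Unlike ring_quotient's [idealr_closed], this allows the unit ideal, and it
   applies to subsets that need not be decidable. *)
Definition is_ideal I : Prop :=
  [/\ I 0, forall p q, I p -> I q -> I (p + q) & forall r p, I p -> I (r * p)].

Definition ideal_gen G : set R := smallest is_ideal G.

Definition ideal_mul I J : set R :=
  ideal_gen [set r | exists p q, [/\ I p, J q & r = p * q]].

Definition ideal_exp I (k : nat) : set R := iter k (ideal_mul I) setT.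

Definition ideal_colon I J : set R := [set p | forall q, J q -> I (p * q)].

End Ideals.

Section MonomialIdeals.
Variables (n : nat) (K : fieldType).
Implicit Type I : set {mpoly K[n]}.

Definition max_ideal : set {mpoly K[n]} :=
  ideal_gen [set p | exists i : 'I_n, p = 'X_i].

Definition colon_pow I (k : nat) : set {mpoly K[n]} :=
  ideal_colon I (ideal_exp max_ideal k).

Definition monomials : set {mpoly K[n]} :=
  [set p | exists b : 'X_{1..n}, p = 'X_[b]].

Definition Jideal I (l : nat) : set {mpoly K[n]} :=
  if l is k.+1 then ideal_gen (monomials `&` (colon_pow I k.+1 `\` colon_pow I k))
  else I.

(* [is_sat I k] says that sat(I), the least k with I : m^k = I : m^(k+1),
   exists and equals k. *)
Definition is_sat I (k : nat) : Prop :=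
  colon_pow I k = colon_pow I k.+1 /\
  (forall j, colon_pow I j = colon_pow I j.+1 -> (k <= j)%N).

(* When no monomial satisfies the constraints, e.g. if [d < 0] or some
   [a 0 i < 0], the generating set is empty and the ideal is [set 0]. *)
Definition veronese (a : 'rV[int]_n) (d : int) : set {mpoly K[n]} :=
  ideal_gen [set p | exists b : 'X_{1..n},
    [/\ (\sum_i b i)%N%:Z = d, forall i, (b i)%:Z <= a 0 i & p = 'X_[b]]].

End MonomialIdeals.

Arguments veronese {n} K a d _.

Lemma ltn_pred_gt1 n : (1 < n)%N -> (n.-1 < n)%N.
Proof. by case: n. Qed.

Definition last_ord n (n_gt1 : (1 < n)%N) : 'I_n := Ordinal (ltn_pred_gt1 n_gt1).

(* Main.v *)
(* Write P for the up-closed set of exponents of monomials in I.  A monomial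
   [x^c] lies in I : m^k iff [c + u] is in P for every u of degree k.  If [x^c]
   is in I : m^(l+1) but not in I : m^l, take u of degree l with [c + u] not in
   P; adding any unit vector to [c + u] lands in P, which forces
   |c + u| = d - 1 and [c + u <= a - e].  Moving all of the degree l + 1 onto
   a single variable x_i then gives [c_i + l + 1 <= a_i].  So the monomials of
   (I : m^(l+1)) \ (I : m^l) are exactly the generators of the shifted Veronese
   type ideal, and the saturation number is the largest shift for which such
   generators exist. *)
Require Import Defs.
From mathcomp Require Import all_boot all_order all_algebra.
From mathcomp Require Import classical_sets.
From mathcomp Require Import mpoly.
From mathcomp Require Import boolp zify.

Set Implicit Arguments.
Unset Strict Implicit.
Unset Printing Implicit Defensive.

Local Open Scope ring_scope.

Local Open Scope classical_set_scope.

Import Order.TTheory GRing.Theory Num.Theory.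

(** * Monomial ideals and their colons, read off on exponents *)

Section SuppIdeals.
Variables (n : nat) (K : fieldType).
Implicit Types (P B : 'X_{1..n} -> Prop) (b c u v m : 'X_{1..n}).

Definition up_closed P := forall b c, (b <= c)%MM -> P b -> P c.

Definition up_closure B c := exists2 b, B b & (b <= c)%MM.

(** For up-closed [P] this is the monomial ideal whose monomials have their exponents in [P]. *)
Definition supp_ideal P : set {mpoly K[n]} :=
  [set p | forall c, c \in msupp p -> P c].

Lemma lepm_trans b c m : (b <= c)%MM -> (c <= m)%MM -> (b <= m)%MM.
Proof.
move=> /mnm_lepP bc /mnm_lepP cm; apply/mnm_lepP => i.
exact: leq_trans (bc i) (cm i).
Qed.

Lemma lepm_mdeg b c : (b <= c)%MM -> (mdeg b <= mdeg c)%N.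
Proof. by move=> /mnm_lepP bc; rewrite !mdegE leq_sum. Qed.

Lemma lepm_mdeg_eq b c : (b <= c)%MM -> mdeg b = mdeg c -> b = c.
Proof.
move=> le_bc; rewrite -{1 2}(submK le_bc) mdegD -{1}[mdeg b]add0n.
by move/addIn/esym/eqP; rewrite mdeg_eq0 => /eqP->; rewrite add0m.
Qed.

(** Grow [b] from 0 one unit at a time: while its degree is below that of [v], some coordinate still
    has room. *)
Lemma exists_lepm_mdeg k v :
  (k <= mdeg v)%N -> exists2 b, mdeg b = k & (b <= v)%MM.
Proof.
elim: k => [|k IHk] lt_k.
  by exists 0%MM; [exact: mdeg0 | apply/mnm_lepP => i; rewrite mnm0E].
have [b deg_b /mnm_lepP le_bv] := IHk (ltnW lt_k).
have /existsP[i lt_i] : [exists i, (b i < v i)%N].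
  apply: contraTT lt_k; rewrite negb_exists => /forallP nlt.
  rewrite -leqNgt -deg_b !mdegE.
  by apply: leq_sum => i _; rewrite leqNgt.
exists (b + U_(i))%MM; first by rewrite mdegD mdeg1 deg_b addn1.
apply/mnm_lepP => j; rewrite mnmDE mnm1E.
by case: eqP => [<-|_]; rewrite ?addn1 ?addn0.
Qed.

Lemma up_closureP B : up_closed (up_closure B).
Proof.
by move=> b c le_bc [m Bm le_mb]; exists m => //; apply: lepm_trans le_bc.
Qed.

Lemma supp_idealX P c : supp_ideal P 'X_[c] <-> P c.
Proof.
split=> [|Pc b]; first by apply; rewrite msuppX inE.
by rewrite msuppX inE => /eqP->.
Qed.

Lemma supp_ideal_ideal P : up_closed P -> is_ideal (supp_ideal P).
Proof.
move=> upP; split=> [c|p q Pp Pq c|r p Pp c].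
- by rewrite msupp0.
- by move=> /msuppD_le; rewrite mem_cat => /orP[/Pp|/Pq].
- move=> /msuppM_le/allpairsP[[b m] [_ /Pp Pm ->]].
  by apply: upP Pm; apply: lem_addl.
Qed.

Lemma supp_ideal_sub P (I : set {mpoly K[n]}) :
  is_ideal I -> (forall c, P c -> I 'X_[c]) -> supp_ideal P `<=` I.
Proof.
move=> [I0 ID IM] PI p Pp; rewrite (mpolyE p) big_seq.
elim/big_ind: _ => // c /Pp/PI Ic.
by rewrite -mul_mpolyC; apply: IM.
Qed.

Lemma ideal_gen_ideal (R : comNzRingType) (G : set R) : is_ideal (ideal_gen G).
Proof.
split=> [A [[A0 AD AM] _]//|p q Ip Iq A GA|r p Ip A GA];
  have [[A0 AD AM] _] := GA.
- by apply: AD; [exact: Ip | exact: Iq].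
- by apply: AM; exact: Ip.
Qed.

Lemma ideal_gen_monomials B :
  ideal_gen [set p : {mpoly K[n]} | exists2 b, B b & p = 'X_[b]]
  = supp_ideal (up_closure B).
Proof.
apply/seteqP; split.
  apply: smallest_sub; first exact/supp_ideal_ideal/up_closureP.
  by move=> _ [b Bb ->]; apply/supp_idealX; exists b => //; apply: lepm_refl.
apply: supp_ideal_sub; first exact: ideal_gen_ideal.
move=> c [b Bb le_bc]; rewrite -(submK le_bc) mpolyXD.
have [_ _ IM] :=
  ideal_gen_ideal [set p : {mpoly K[n]} | exists2 b, B b & p = 'X_[b]].
by apply: IM; apply: sub_gen_smallest; exists b.
Qed.

Lemma up_closed_mdeg k : up_closed (fun c => (k <= mdeg c)%N).
Proof. by move=> b c /lepm_mdeg le_bc le_kb; apply: leq_trans le_bc. Qed.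

(** Induction on [k]: degrees add under products, and conversely a monomial of degree at least
    [k.+1] splits off one variable. *)
Lemma max_ideal_exp k :
  ideal_exp (@max_ideal n K) k = supp_ideal (fun c => (k <= mdeg c)%N).
Proof.
elim: k => [|k IHk]; first by apply/seteqP; split.
rewrite /ideal_exp iterS -/(ideal_exp _ _) IHk; apply/seteqP; split.
  apply: smallest_sub; first exact/supp_ideal_ideal/up_closed_mdeg.
  move=> _ [p [q [max_p deg_q ->]]] c /msuppM_le/allpairsP[[b m] /=].
  have deg_p : supp_ideal (fun c => (1 <= mdeg c)%N) p.
    move: p max_p {q deg_q}; apply: smallest_sub.
      exact/supp_ideal_ideal/up_closed_mdeg.
    by move=> _ [i ->]; apply/supp_idealX; rewrite mdeg1.
  by move=> [/deg_p deg_b /deg_q deg_m ->]; rewrite mdegD (leq_add deg_b).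
apply: supp_ideal_sub; first exact: ideal_gen_ideal.
move=> c lt_kc.
have [b /eqP/mdeg1P[i /eqP->] le_ic] : exists2 b, mdeg b = 1%N & (b <= c)%MM.
  exact/exists_lepm_mdeg/(leq_trans _ lt_kc).
rewrite -(submK le_ic) mpolyXD mulrC.
apply: sub_gen_smallest; exists 'X_i, 'X_[c - U_(i)]; split=> //.
  by apply: sub_gen_smallest; exists i.
apply/supp_idealX.
by move: lt_kc; rewrite -{1}(submK le_ic) mdegD mdeg1 addn1.
Qed.

Definition colon_exponents P k c := forall u, mdeg u = k -> P (c + u)%MM.

(** Multiplying by ['X_[u]] only translates the support, so nothing cancels and the test can be made
    monomial by monomial. Degree exactly [k] suffices, since a larger exponent dominates one of
    degree [k] and [P] is up-closed. *)
Lemma colon_pow_supp_ideal P k : up_closed P ->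
  colon_pow (supp_ideal P) k = supp_ideal (colon_exponents P k).
Proof.
move=> upP; rewrite /colon_pow max_ideal_exp.
apply/seteqP; split=> p Ip.
  move=> c pc u deg_u; apply: (Ip 'X_[u]).
    by apply/supp_idealX; rewrite deg_u.
  by rewrite mcoeff_msupp addmC mcoeffMX -mcoeff_msupp.
move=> q deg_q _ /msuppM_le/allpairsP[[c u] /= [/Ip Ic /deg_q deg_u ->]].
have [b /Ic Pcb /mnm_lepP le_bu] := exists_lepm_mdeg deg_u.
by apply: upP Pcb; apply/mnm_lepP => i; rewrite !mnmDE leq_add2l.
Qed.

Lemma supp_ideal_inj : injective supp_ideal.
Proof.
move=> P Q eqPQ; apply/funext => c; apply/propext.
by rewrite -!supp_idealX eqPQ.
Qed.

Lemma colon_exponentsS P k c : up_closed P ->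
  colon_exponents P k c -> colon_exponents P k.+1 c.
Proof.
move=> upP Pc u deg_u.
have [|b /Pc Pcb /mnm_lepP le_bu] := @exists_lepm_mdeg k u.
  by rewrite deg_u.
by apply: upP Pcb; apply/mnm_lepP => i; rewrite !mnmDE leq_add2l.
Qed.

(** The colons increase with [k], so they can differ only by a new exponent at [k.+1]. *)
Lemma colon_exponents_eqP P k : up_closed P ->
  colon_exponents P k = colon_exponents P k.+1 <->
  ~ exists c, colon_exponents P k.+1 c /\ ~ colon_exponents P k c.
Proof.
move=> upP; split=> [-> [c []]//|nex].
apply/funext => c; apply/propext; split; first exact: colon_exponentsS.
by move=> Pc; apply: contrapT => nPc; apply: nex; exists c.
Qed.

End SuppIdeals.

(** * Exponents of Veronese type generators *)

Section VeroneseExponents.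
Variable n : nat.
Implicit Types (a : 'rV[int]_n) (d : int) (b c u : 'X_{1..n}).

Definition veronese_exponent a d b :=
  (mdeg b)%:Z = d /\ forall i, (b i)%:Z <= a 0 i.

Lemma veroneseE (K : fieldType) a d :
  veronese K a d
  = ideal_gen [set p | exists2 b, veronese_exponent a d b & p = 'X_[b]].
Proof.
congr ideal_gen; apply/seteqP; split=> p [b].
  by case=> deg_b le_ba ->; exists b => //; split; rewrite ?mdegE.
by case=> deg_b le_ba ->; exists b; split=> //; rewrite -mdegE.
Qed.

Lemma shift_entryE a l i : (a - l%:Z *: const_mx 1) 0 i = a 0 i - l%:Z.
Proof. by rewrite !mxE mulr1. Qed.

Lemma colon_exponents_diff a d l c : (0 < n)%N -> 0 <= d ->
  let P := up_closure (veronese_exponent a d) in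
  colon_exponents P l.+1 c /\ ~ colon_exponents P l c <->
  veronese_exponent (a - l.+1%:Z *: const_mx 1) (d - l.+1%:Z) c.
Proof.
move=> n_gt0 d_ge0 P; pose i0 := Ordinal n_gt0; split=> [[Pc]|[deg_c le_ca]].
  move=> /existsNP[u /not_implyP[deg_u nPcu]].
  have cu_bounds i : ((c + u)%MM i)%:Z < a 0 i /\ (mdeg (c + u)%MM)%:Z >= d - 1.
    have [|b [deg_b le_ba] /mnm_lepP le_bcu] := Pc (u + U_(i))%MM.
      by rewrite mdegD mdeg1 deg_u addn1.
    have le_b j : (b j <= (c + u)%MM j + (i == j))%N.
      by rewrite -mnm1E -mnmDE -addmA.
    split; last first.
      have : (b <= (c + u) + U_(i))%MM.
        by apply/mnm_lepP => j; rewrite mnmDE mnm1E.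
      by move=> /lepm_mdeg; rewrite (mdegD _ U_(i)%MM) mdeg1; lia.
    have := le_ba i; have := le_b i; rewrite eqxx.
    (* The generator [b] must use the added unit at [i], so [b i] is [(c + u) i + 1]; otherwise [b]
       already lies below [c + u]. *)
    case: (leqP (b i) ((c + u)%MM i)) => [le_bi|]; last by lia.
    case: nPcu; exists b => //; apply/mnm_lepP => j.
    by have := le_b j; case: eqP => [<-|_]; rewrite // addn0.
  (* Were the degree at least [d], any exponent of degree [d] below [c + u] would respect the bounds
     [a], putting [c + u] in [P]. *)
  have deg_lt : (mdeg (c + u)%MM)%:Z < d.
    rewrite ltNge; apply/negP => le_d; apply: nPcu.
    have [|b deg_b le_b] := @exists_lepm_mdeg _ `|d|%N (c + u)%MM; first by lia.
    exists b => //; split=> [|i]; first by lia.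
    by move/mnm_lepP: le_b => /(_ i); have [] := cu_bounds i; lia.
  have deg_c : (mdeg c)%:Z = d - l.+1%:Z.
    by have [_] := cu_bounds i0; move: deg_lt; rewrite mdegD; lia.
  split=> // i; rewrite shift_entryE.
  have [|b [deg_b le_ba] le_bc] := Pc (U_(i) *+ l.+1)%MM.
    by rewrite mdegMn mdeg1 mul1n.
  (* Both sides have degree [d], so the generator is [c + U_(i) *+ l.+1] itself and obeys the bound
     at [i]. *)
  have := le_ba i; rewrite (lepm_mdeg_eq le_bc); last first.
    by rewrite mdegD mdegMn mdeg1; lia.
  by rewrite mnmDE mulmnE mnm1E eqxx; lia.
split=> [u deg_u|].
  exists (c + u)%MM; last exact: lepm_refl.
  split=> [|i]; first by rewrite mdegD; lia.
  have := le_ca i; rewrite shift_entryE mnmDE.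
  have : (u i <= mdeg u)%N by rewrite mdegE (bigD1 i) //= leq_addr.
  by lia.
(* Any [u] of degree [l] would do: [c + u] has degree [d - 1], too small to dominate a generator. *)
move=> /(_ (U_(i0) *+ l)%MM); rewrite mdegMn mdeg1 mul1n => /(_ erefl)[b].
by case=> deg_b _ /lepm_mdeg; rewrite mdegD mdegMn mdeg1; lia.
Qed.


(** For the converse, [a] itself is an exponent of degree at least [d]; cut it down to degree
    [d]. *)
Lemma exists_veronese_exponent a d :
  (exists b, veronese_exponent a d b) <->
  [/\ 0 <= d, forall i, 0 <= a 0 i & d <= \sum_i a 0 i].
Proof.
split=> [[b [<- le_ba]]|[d_ge0 a_ge0 le_d]].
  split=> // [i|]; first exact: le_trans (le_ba i).
  by rewrite mdegE (big_morph Posz PoszD (erefl 0)); apply: ler_sum.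
pose v := [multinom absz (a 0%R i) | i < n].
have vE i : (v i)%:Z = a 0 i by rewrite mnmE gez0_abs.
have [|b deg_b /mnm_lepP le_bv] := @exists_lepm_mdeg n `|d|%N v.
  rewrite -lez_nat gez0_abs // mdegE (big_morph Posz PoszD (erefl 0)).
  by under eq_bigr do rewrite vE.
exists b; split=> [|i]; first by rewrite deg_b gez0_abs.
by rewrite -vE lez_nat.
Qed.

End VeroneseExponents.

Theorem theorem4p3 (K : fieldType) (n : nat) (n_gt1 : (1 < n)%N)
    (a : 'rV[int]_n) (d : int)
    (d_ge0 : 0 <= d)
    (a_noninc : forall i j : 'I_n, (i <= j)%N -> a 0 j <= a 0 i)
    (an_ge0 : 0 <= a 0 (last_ord n_gt1))
    (sum_a_ge : d <= \sum_(i < n) a 0 i) :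
  (forall l : nat,
     Jideal (veronese K a d) l
     = veronese K (a - l%:Z *: const_mx 1) (d - l%:Z))
  /\
  (exists k : nat,
     is_sat (veronese K a d) k
     /\ k%:Z = Num.min (((\sum_(i < n) a 0 i - d) %/ (n%:Z - 1))%Z)
                       (Num.min (a 0 (last_ord n_gt1)) d)).
Proof.
have n_gt0 : (0 < n)%N := ltnW n_gt1.
pose P := up_closure (veronese_exponent a d).
have upP : up_closed P := @up_closureP _ _.
have colonE k : colon_pow (veronese K a d) k = supp_ideal (colon_exponents P k).
  by rewrite veroneseE ideal_gen_monomials colon_pow_supp_ideal.
split=> [[|l]|]; first by rewrite scale0r !subr0.
  rewrite [RHS]veroneseE /Jideal !colonE; congr ideal_gen.
  apply/seteqP; split=> [_ [[b ->]]|_ [b /colon_exponents_diff[]// Pb nPb ->]].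
    move=> [/supp_idealX Pb] nPb; exists b => //.
    apply/colon_exponents_diff => //; split=> // Pb'.
    by apply: nPb; apply/supp_idealX.
  by split; [exists b | split; [apply/supp_idealX | move/supp_idealX]].
set q := (_ %/ _)%Z; set s := Num.min _ _.
have sP m : m%:Z <= s <->
    exists c, veronese_exponent (a - m%:Z *: const_mx 1) (d - m%:Z) c.
  (* Shifting by [m] lowers the entry sum by [m * n] and the degree by [m], so the sum condition
     becomes [m * (n - 1) <= \sum_i a 0 i - d]; hence the floor. *)
  rewrite exists_veronese_exponent !le_min lez_divRL; last by lia.
  rewrite mulrBr mulr1.
  have -> : \sum_i (a - m%:Z *: const_mx 1) 0 i = \sum_i a 0 i - m%:Z * n%:Z.
    under eq_bigr do rewrite shift_entryE.
    by rewrite sumrB sumr_const card_ord -mulrzz -pmulrn.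
  move: (\sum_i _) => t.
  split=> [/and3P[le_mq le_ma le_md]|[le_md le_ma le_mq]].
    split=> [|i|]; [by lia | | by lia].
    (* The last entry of [a] is the smallest, so it controls all of them. *)
    by rewrite shift_entryE subr_ge0 (le_trans le_ma) // a_noninc //= -ltnS prednK.
  have := le_ma (last_ord n_gt1); rewrite shift_entryE => le_man.
  by apply/and3P; split; lia.
(* New monomials at [k.+1] are the generators for the shift [k.+1], which exist exactly up to [s];
   the least stable index is thus [s], once [0 <= s]. *)
have stepE k : colon_pow (veronese K a d) k = colon_pow (veronese K a d) k.+1
    <-> s < k.+1%:Z.
  have -> : colon_pow (veronese K a d) k = colon_pow (veronese K a d) k.+1
      <-> colon_exponents P k = colon_exponents P k.+1.
    by rewrite !colonE; split=> [/supp_ideal_inj|->].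
  rewrite colon_exponents_eqP // ltNge; split=> [nex|/negP nle [c]].
    apply/negP => /sP[c Pc]; apply: nex; exists c.
    exact/colon_exponents_diff.
  by move=> /(colon_exponents_diff _ _ _ n_gt0 d_ge0) Pc; apply/nle/sP; exists c.
have s_ge0 : 0 <= s.
  by rewrite !le_min an_ge0 d_ge0 /q divz_ge0; lia.
exists `|s|%N; split; last by rewrite gez0_abs.
split=> [|j]; first by apply/stepE; lia.
by move/stepE; lia.
Qed.
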